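(* Let $\Gamma=(\mathcal N,(Y_i,u_i)_{i\in\mathcal N})$ be a finite normal-form game with $\mathcal{N}=\{1,\dots,N\}$, let $Z\subset\mathbb R^m$ be compact, and for each $i\in\mathcal N$ let $f_i:Z\to\Delta(Y_{-i})$ be continuous. Let $\{\epsilon_n\}$ be a sequence of nonnegative numbers with $\epsilon_n\to0$ as $n\to\infty$. Then there exists a sequence of positive numbers $\delta_n\to0$ (not depending on $z$) such that $$BR_{f,\epsilon_n}(z)\subseteq BR_f^{\delta_n}(z)\qquad\text{for all } n \text{ and all } z\in Z.$$
   Context: $Y_i$ is the finite action set of player $i$, $Y=\prod_iY_i$, $Y_{-i}=\prod_{j\ne i}Y_j$, $u_i:Y\to\mathbb R$ is the utility of player $i$. For a finite set $X$, $\Delta(X)$ is the set of probability distributions on $X$. For $x\in\Delta(Y)$, $U_i(x)=\sum_{y\in Y}u_i(y)x(y)$; for $x_i\in\Delta(Y_i)$, $x_{-i}\in\Delta(Y_{-i})$ (possibly correlated), $U_i(x_i,x_{-i})$ is the expected utility under the product of $x_i$ and $x_{-i}$. For $\epsilon\ge0$, $$BR_{i,\epsilon}(x_{-i})=\{\tilde x_i\in\Delta(Y_i):U_i(\tilde x_i,x_{-i})\ge\max_{x_i\in\Delta(Y_i)}U_i(x_i,x_{-i})-\epsilon\},\qquad BR_i=BR_{i,0}.$$ Set $BR_f(z)=\prod_{i=1}^NBR_i(f_i(z))$ and $BR_{f,\epsilon}(z)=\prod_{i=1}^NBR_{i,\epsilon}(f_i(z))$ for $z\in Z$, where an $N$-tuple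 $(p_1,\dots,p_N)$ with $p_i\in\Delta(Y_i)$ is identified with the product distribution in $\Delta(Y)$. For $\delta>0$ the $\delta$-perturbation of $BR_f$ is $$BR_f^{\delta}(z)=\{y:\ \exists z'\in Z \text{ with } \|z'-z\|<\delta \text{ and } d(y,BR_f(z'))<\delta\},$$ where $d(y,S)=\inf\{\|y-s\|:s\in S\}$. *)

(* Defs.v *)
From HB Require Import structures.
From mathcomp Require Import all_boot all_order all_algebra.
From mathcomp Require Import all_classical all_reals all_analysis.

Set Implicit Arguments.
Unset Strict Implicit.
Unset Printing Implicit Defensive.

Import Order.TTheory GRing.Theory Num.Theory.
Import numFieldNormedType.Exports.

Local Open Scope classical_set_scope.
Local Open Scope ring_scope.

(* The norm the library puts on row vectors is the sup norm; this is the
   Euclidean one. *)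
Definition eucl_norm (R : realType) (I : finType) (x : I -> R) : R :=
  Num.sqrt (\sum_(i : I) x i ^+ 2).

(* [ereal_inf] rather than [inf], so that the distance to the empty set is +oo
   and not 0. *)
Definition eucl_dist_set (R : realType) (I : finType) (x : I -> R)
    (S : set (I -> R)) : \bar R :=
  ereal_inf [set (eucl_norm (fun i => x i - s i))%:E | s in S].

Definition Delta (R : realType) (X : finType) : set (X -> R) :=
  [set p | (forall x, 0 <= p x) /\ \sum_(x : X) p x = 1].
Arguments Delta : clear implicits.

Section Game.
Variables (R : realType) (N : nat) (Y : 'I_N -> finType).

Definition profile : finType := {dffun forall i : 'I_N, Y i}.

Definition profile_others (i : 'I_N) : finType :=
  {dffun forall j : {j : 'I_N | j != i}, Y (val j)}.

Definition others (i : 'I_N) (y : profile) : profile_others i :=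
  [ffun j : {j : 'I_N | j != i} => y (val j)].

Definition prod_with_others (i : 'I_N) (p : Y i -> R)
    (q : profile_others i -> R) : profile -> R :=
  fun y => p (y i) * q (others i y).

Definition prod_dist (p : forall i : 'I_N, Y i -> R) : profile -> R :=
  fun y => \prod_(i < N) p i (y i).

Variable u : 'I_N -> profile -> R.

Definition U (i : 'I_N) (x : profile -> R) : R :=
  \sum_(y : profile) u i y * x y.

Definition U_against (i : 'I_N) (p : Y i -> R)
    (q : profile_others i -> R) : R :=
  U i (prod_with_others p q).

(* [p |-> U_against p q] is linear and the simplex is compact and nonempty when
   [Y i] is, so the maximum exists and is the supremum. *)
Definition max_U (i : 'I_N) (q : profile_others i -> R) : R :=
  sup [set U_against p q | p in Delta R (Y i)].

Definition BRi_eps (i : 'I_N) (eps : R) (q : profile_others i -> R) :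
    set (Y i -> R) :=
  [set p | Delta R (Y i) p /\ U_against p q >= max_U q - eps].

Definition BRi (i : 'I_N) (q : profile_others i -> R) : set (Y i -> R) :=
  BRi_eps 0 q.

Variables (m : nat) (Z : set 'rV[R]_m).
Variable f : forall i : 'I_N, 'rV[R]_m -> profile_others i -> R.
Arguments f : clear implicits.

Definition BRf_eps (eps : R) (z : 'rV[R]_m) : set (profile -> R) :=
  [set prod_dist p | p in [set p : forall i : 'I_N, Y i -> R |
                            forall i, BRi_eps eps (f i z) (p i)]].

Definition BRf (z : 'rV[R]_m) : set (profile -> R) :=
  [set prod_dist p | p in [set p : forall i : 'I_N, Y i -> R |
                            forall i, BRi (f i z) (p i)]].

Definition BRf_pert (delta : R) (z : 'rV[R]_m) : set (profile -> R) :=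
  [set y | exists z' : 'rV[R]_m,
     [/\ Z z',
         eucl_norm (fun k : 'I_m => (z' - z) ord0 k) < delta &
         (eucl_dist_set y (BRf z') < delta%:E)%E]].

End Game.

(* Main.v *)
Require Import Defs.
From HB Require Import structures.
From mathcomp Require Import all_boot all_order all_algebra.
From mathcomp Require Import all_classical all_reals all_analysis.
From mathcomp Require Import ring lra.

(** The inclusion is a quantitative upper hemicontinuity of the approximate
    best response correspondence, made uniform by the compactness of [Z].

    Fix [x] in [Z] and a player [i].  Against [f i x] the pure actions of [i]
    that are not optimal lose at least some gap [g > 0].  If [z] is so close
    to [x] that each pure payoff moved by at most [t], then a mixed action
    that is [e]-optimal against [f i z] loses at most [e + 2 * t] against
    [f i x], hence it puts mass at most [(e + 2 * t) / g] on the non-optimal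
    actions.  Moving this mass to one optimal action yields an exact best
    response to [f i x] that differs from the given mixed action by at most
    [(e + 2 * t) / g] in each coordinate ([move_mass_to_maximizers],
    [BRi_near]).
    A product of probabilities is 1-Lipschitz in each factor, so the product
    distributions are close too ([dist_BRf_le]).  Thus for each [d > 0] the
    inclusion in the [d]-perturbation holds for [z] near [x] and [n] large,
    with [x] itself as the perturbed point ([BRf_eps_near]).

    The gap [g] depends on [x] and may have no positive lower bound on [Z];
    the near-covering form of compactness nevertheless gives, for each [d],
    one rank [n] beyond which the inclusion holds for all [z] in [Z].  A radius
    that works for all [n] and [z] also exists, because distributions are
    within bounded distance of each other ([BRf_eps_sub_pert]).  As enlarging
    the radius keeps the inclusion, these two facts suffice to choose radii
    tending to 0 ([vanishing_radii]). *)

Set Implicit Arguments.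
Unset Strict Implicit.
Unset Printing Implicit Defensive.

Import Order.TTheory GRing.Theory Num.Theory.
Import numFieldNormedType.Exports.

Local Open Scope classical_set_scope.
Local Open Scope ring_scope.

(** * Elementary estimates *)

Lemma eucl_norm_le_card (R : realType) (I : finType) (x : I -> R) (c : R) :
  (forall i, `|x i| <= c) -> 0 <= c -> eucl_norm x <= #|I|%:R * c.
Proof.
move=> xc c0; rewrite /eucl_norm.
have Kc0 : 0 <= #|I|%:R * c by rewrite mulr_ge0.
rewrite -[leRHS](ger0_norm Kc0) -sqrtr_sqr ler_wsqrtr//.
apply: (@le_trans _ _ (\sum_(i : I) c ^+ 2)).
  apply: ler_sum => i _; rewrite -real_normK ?num_real//.
  by rewrite lerXn2r// nnegrE.
rewrite sumr_const -[leLHS]mulr_natl exprMn ler_wpM2r ?sqr_ge0//.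
by rewrite -natrX ler_nat; case: #|I| => // k; rewrite -mulnn leq_pmull.
Qed.

(** Replacing the factors one at a time changes the product by at most the
    change of that factor, since the other factors have absolute value at
    most 1. *)
Lemma dist_prod_le_sum (R : realDomainType) (I : Type) (r : seq I)
    (F G : I -> R) :
  (forall i, 0 <= F i <= 1) -> (forall i, 0 <= G i <= 1) ->
  `|\prod_(i <- r) F i - \prod_(i <- r) G i| <= \sum_(i <- r) `|F i - G i|.
Proof.
move=> F01 G01.
(* The bounds on the products are needed to go through the induction. *)
suff [] : [/\ 0 <= \prod_(i <- r) F i <= 1, 0 <= \prod_(i <- r) G i <= 1 &
  `|\prod_(i <- r) F i - \prod_(i <- r) G i| <= \sum_(i <- r) `|F i - G i|].
  by [].
elim: r => [|i r [/andP[f0 f1] /andP[g0 g1] IH]].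
  by rewrite !big_nil subrr normr0 ler01 lexx.
rewrite !big_cons.
have /andP[Fi0 Fi1] := F01 i; have /andP[Gi0 Gi1] := G01 i.
split; rewrite ?mulr_ge0 ?mulr_ile1//.
set a := \prod_(j <- r) F j in f0 f1 IH *.
set b := \prod_(j <- r) G j in g0 g1 IH *.
have -> : F i * a - G i * b = (F i - G i) * a + G i * (a - b) by ring.
rewrite (le_trans (ler_normD _ _))// !normrM lerD//.
  by rewrite ler_piMr// ger0_norm.
by rewrite (le_trans _ IH)// ler_piMl// ger0_norm.
Qed.

Lemma Delta_le1 (R : realType) (X : finType) (p : X -> R) (x : X) :
  Delta R X p -> 0 <= p x <= 1.
Proof.
move=> [p0 <-]; rewrite p0 (bigD1 x)//= lerDl.
by apply: sumr_ge0 => y _; exact: p0.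
Qed.

Lemma Delta_inhabited (R : realType) (X : finType) (p : X -> R) :
  Delta R X p -> inhabited X.
Proof.
move=> [_ p1]; case: (pickP (fun _ : X => true)) => [x _|X0]; first by split.
by move: p1; rewrite big_pred0// => /eqP; rewrite eq_sym oner_eq0.
Qed.

(** * Approximate maximizers of a linear form on the simplex *)

Lemma Delta_point (R : realType) (X : finType) (b : X) :
  Delta R X (fun x => (x == b)%:R).
Proof.
split=> [x|]; first exact: ler0n.
by rewrite (bigD1 b)//= eqxx big1 ?addr0// => x /negbTE->.
Qed.

Lemma sum_point (R : realType) (X : finType) (b : X) (v : X -> R) :
  \sum_x (x == b)%:R * v x = v b.
Proof.
by rewrite (bigD1 b)//= eqxx mul1r big1 ?addr0// => x /negbTE->; rewrite mul0r.
Qed.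

(** [v] is the exact linear form and [w] a perturbation of it.  The constant
    [g] is the gap between the maximum of [v] and its next value, capped at 1,
    so it depends on [v] alone.  An [e]-maximizer [p] for [w] loses at most
    [e + 2 * t] for [v], hence has mass at most [(e + 2 * t) / g] off the
    maximizers of [v], and [s] arises from [p] by moving this mass to one of
    them. *)
Lemma move_mass_to_maximizers (R : realType) (X : finType) (v : X -> R) :
  exists2 g : R, 0 < g & forall (w p : X -> R) (e t : R),
    Delta R X p ->
    (forall a, `|w a - v a| <= t) ->
    (forall b, w b <= \sum_a p a * w a + e) ->
    exists s : X -> R,
      [/\ Delta R X s,
          forall p', Delta R X p' -> \sum_a p' a * v a <= \sum_a s a * v a &
          forall a, `|p a - s a| <= (e + 2 * t) / g].
Proof.
case: (pickP (fun _ : X => true)) => [a0 _|X0]; last first.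
  exists 1 => // w p e t /Delta_inhabited[x].
  by have := X0 x.
have [b vb] : exists b, forall a, v a <= v b.
  case: (arg_maxP v (isT : xpredT a0)) => b _ vb.
  by exists b => a; exact: vb.
pose bad a := v a < v b.
(* The default value 1 keeps [g] positive when all points maximize [v]. *)
pose g : R := \big[Order.min/1]_(a | bad a) (v b - v a).
have g0 : 0 < g by apply: lt_bigmin => // a; rewrite /bad subr_gt0.
have gle a : bad a -> g <= v b - v a.
  exact: (@bigmin_le_cond _ _ _ _ a bad (fun a => v b - v a)).
exists g => // w p e t [p0 p1] wv wb.
pose beta := \sum_(a | bad a) p a.
have beta0 : 0 <= beta by apply: sumr_ge0.
(* Averaged over [p], the loss [w b - w a] is at most [e]; enlarged by [2 * t]
   it is nonnegative everywhere and at least [g] at the bad points. *)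
have beta_le : beta <= (e + 2 * t) / g.
  rewrite ler_pdivlMr// mulr_suml big_mkcond/=.
  apply: (@le_trans _ _ (\sum_a p a * (w b + 2 * t - w a))).
    apply: ler_sum => a _; have := wv a; have := wv b.
    rewrite !ler_norml => /andP[h1 h2] /andP[h3 h4].
    case: ifPn => [/gle ga|_]; first by rewrite ler_wpM2l//; lra.
    by rewrite mulr_ge0//; have := vb a; lra.
  under eq_bigr do rewrite mulrBr.
  rewrite sumrB -mulr_suml p1 mul1r.
  by have := wb b; lra.
pose s a := (if bad a then 0 else p a) + (if a == b then beta else 0).
have badb : bad b = false by rewrite /bad ltxx.
have s1 : \sum_a s a = 1.
  rewrite big_split/= -[X in _ + X]big_mkcond/= big_pred1_eq.
  rewrite -p1 [RHS](bigID bad)/= addrC; congr (_ + _).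
  by rewrite [RHS]big_mkcond/=; apply: eq_bigr => a _; case: (bad a).
have sv : \sum_a s a * v a = v b.
  rewrite -[RHS]mul1r -s1 mulr_suml; apply: eq_bigr => a _.
  rewrite /s; case: ifPn => [ba|nba].
    case: eqVneq => [ab|_]; last by rewrite addr0 !mul0r.
    by move: ba; rewrite ab badb.
  congr (_ * _); apply/eqP; rewrite eq_le vb/=.
  by rewrite leNgt.
exists s; split.
- by split=> // a; rewrite /s addr_ge0//; case: ifP.
- move=> p' [p'0 p'1]; rewrite sv -[leRHS]mul1r -p'1 mulr_suml.
  by apply: ler_sum => a _; rewrite ler_wpM2l.
- move=> a; apply: le_trans beta_le; rewrite /s.
  case: ifPn => [ba|nba].
    case: eqVneq => [ab|_]; first by move: ba; rewrite ab badb.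
    rewrite addr0 subr0 ger0_norm// /beta (bigD1 a)//= lerDl.
    by apply: sumr_ge0.
  case: eqVneq => _; last by rewrite addr0 subrr normr0.
  by rewrite opprD addrA subrr sub0r normrN ger0_norm.
Qed.

(** * Best responses *)

Section BestResponses.
Variables (R : realType) (N : nat) (Y : 'I_N -> finType).
Variable u : 'I_N -> profile Y -> R.

Definition pure_payoff (i : 'I_N) (q : profile_others Y i -> R) (a : Y i) : R :=
  \sum_(y : profile Y | y i == a) u i y * q (others i y).

Lemma U_againstE (i : 'I_N) (p : Y i -> R) (q : profile_others Y i -> R) :
  U_against u p q = \sum_a p a * pure_payoff q a.
Proof.
rewrite /U_against /U (partition_big (fun y : profile Y => y i) predT)//=.
apply: eq_bigr => a _; rewrite /pure_payoff mulr_sumr.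
by apply: eq_bigr => y /eqP <-; rewrite /prod_with_others mulrCA.
Qed.

Lemma pure_payoff_cvg (i : 'I_N) (T : Type) (F : set_system T)
    (q : T -> profile_others Y i -> R) (q0 : profile_others Y i -> R)
    (a : Y i) : Filter F ->
  (forall y, q t y @[t --> F] --> q0 y) ->
  pure_payoff (q t) a @[t --> F] --> pure_payoff q0 a.
Proof.
move=> FF qq0; rewrite /pure_payoff.
apply: cvg_big => [|y _]; first exact: add_continuous.
by apply: cvgMr; exact: qq0.
Qed.

(** The absolute pure payoffs bound the set whose supremum is [max_U]; without
    a bound the supremum would be a junk value. *)
Lemma U_against_le_max (i : 'I_N) (p : Y i -> R) (q : profile_others Y i -> R) :
  Delta R (Y i) p -> U_against u p q <= max_U u q.
Proof.
move=> Dp; apply: ub_le_sup; last by exists p.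
exists (\sum_a `|pure_payoff q a|) => _ [p' Dp' <-].
rewrite U_againstE; apply: ler_sum => a _.
have /andP[p0 p1] := Delta_le1 a Dp'.
by rewrite (le_trans (ler_norm _))// normrM ger0_norm// ler_piMl.
Qed.

Lemma BRi_of_max (i : 'I_N) (s : Y i -> R) (q : profile_others Y i -> R) :
  Delta R (Y i) s ->
  (forall p, Delta R (Y i) p -> U_against u p q <= U_against u s q) ->
  BRi u q s.
Proof.
move=> Ds smax; split=> //=; rewrite subr0.
by apply: ge_sup => [|_ [p Dp <-]]; [exists (U_against u s q), s|exact: smax].
Qed.

(** The constant [g] depends on [q0] only, so the last bound tends to 0 as [q]
    tends to [q0] and [e] to 0. *)
Lemma BRi_near (i : 'I_N) (q0 : profile_others Y i -> R) :
  exists2 g : R, 0 < g & forall (q : profile_others Y i -> R) (p : Y i -> R)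
      (e t : R),
    (forall a, `|pure_payoff q a - pure_payoff q0 a| <= t) ->
    BRi_eps u e q p ->
    exists2 s, BRi u q0 s & forall a, `|p a - s a| <= (e + 2 * t) / g.
Proof.
have [g g0 H] := move_mass_to_maximizers (pure_payoff q0).
exists g => // q p e t qt [Dp pe].
have [b|s [Ds smax ps]] := H _ _ e _ Dp qt.
  (* The maximum over mixed actions dominates each pure payoff. *)
  rewrite -U_againstE -lerBlDr (le_trans _ pe)// lerD2r.
  by rewrite -(sum_point b) -U_againstE U_against_le_max//; exact: Delta_point.
exists s => //; apply: BRi_of_max => // p' Dp'.
by rewrite !U_againstE smax.
Qed.

Lemma dist_BRf_le (m : nat) (f : forall i, 'rV[R]_m -> profile_others Y i -> R)
    (z : 'rV[R]_m) (p s : forall i, Y i -> R) (c : R) :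
  0 <= c -> (forall i, Delta R (Y i) (p i)) ->
  (forall i, BRi u (f i z) (s i)) ->
  (forall i a, `|p i a - s i a| <= c) ->
  (eucl_dist_set (prod_dist p) (BRf u f z)
     <= (#|profile Y|%:R * (N%:R * c))%:E)%E.
Proof.
move=> c0 Dp Bs ps.
apply: (@le_trans _ _ (eucl_norm
  (fun y : profile Y => prod_dist p y - prod_dist s y))%:E).
  by apply: ereal_inf_lbound; exists (prod_dist s) => //; exists s.
rewrite lee_fin; apply: eucl_norm_le_card; last by rewrite mulr_ge0.
move=> y; rewrite /prod_dist.
apply: le_trans (dist_prod_le_sum _ _ _) _.
- by move=> i; exact: Delta_le1.
- by move=> i; apply: Delta_le1; have [] := Bs i.
- rewrite (le_trans (ler_sum _ (fun i _ => ps i (y i))))//.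
  by rewrite sumr_const card_ord mulr_natl.
Qed.

End BestResponses.

(** * From the local estimate to a uniform one *)

Section Perturbation.
Variables (R : realType) (N : nat) (Y : 'I_N -> finType).
Variable u : 'I_N -> profile Y -> R.
Variables (m : nat) (Z : set 'rV[R]_m).
Variable f : forall i : 'I_N, 'rV[R]_m -> profile_others Y i -> R.
Arguments f : clear implicits.

Lemma BRf_pert_mono (d d' : R) (z : 'rV[R]_m) : d <= d' ->
  BRf_pert u Z f d z `<=` BRf_pert u Z f d' z.
Proof.
move=> dd' y [z' [Zz' zz' yz']]; exists z'; split=> //.
  exact: lt_le_trans dd'.
by apply: lt_le_trans yz' _; rewrite lee_fin.
Qed.

Lemma pure_payoff_near (i : 'I_N) (x : 'rV[R]_m) (t : R) :
  {within Z, continuous (f i : 'rV[R]_m -> {ptws profile_others Y i -> R})} ->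
  Z x -> 0 < t ->
  \forall z \near within Z (nbhs x),
    forall a, `|pure_payoff u (f i z) a - pure_payoff u (f i x) a| <= t.
Proof.
move=> fc Zx t0; apply: filter_forall => a.
have fx : f i z @[z --> within Z (nbhs x)]
    --> (f i x : {ptws profile_others Y i -> R}).
  by have /subspace_continuousP := fc; apply.
have fxy (y : profile_others Y i) :
    f i z y @[z --> within Z (nbhs x)] --> f i x y.
  exact: (cvg_comp _ _ fx
    (@proj_continuous _ (fun _ => R : topologicalType) y (f i x))).
have wx : pure_payoff u (f i z) a @[z --> within Z (nbhs x)]
    --> pure_payoff u (f i x) a by exact: pure_payoff_cvg.
apply: filterS (cvgr_dist_le _ _ wx _ t0) => z.
by rewrite distrC.
Qed.

Lemma eucl_norm_near (x : 'rV[R]_m) (d : R) : 0 < d ->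
  \forall z \near x, eucl_norm (fun k => (x - z) ord0 k) < d.
Proof.
move=> d0; pose c := d / (m%:R + 1).
have m0 : 0 < m%:R + 1 :> R by rewrite ltr_wpDl.
have c0 : 0 < c by rewrite divr_gt0.
near=> z.
have xz : ball x c z by near: z; exact: nbhsx_ballx.
apply: le_lt_trans (@eucl_norm_le_card _ _ _ c _ _) _; rewrite ?ltW//.
  by move=> k; rewrite !mxE ltW//; exact: xz.2.
by rewrite card_ord /c mulrCA gtr_pMr// ltr_pdivrMr// mul1r ltrDl.
Unshelve. all: by end_near. Qed.

(** The local form of the result: the point of [Z] that witnesses membership in
    the perturbation is [x], the same for all [z] near it. *)
Lemma BRf_eps_near (eps : nat -> R) (x : 'rV[R]_m) (d : R) :
  (forall i : 'I_N,
    {within Z, continuous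
       (f i : 'rV[R]_m -> {ptws profile_others Y i -> R})}) ->
  eps n @[n --> \oo] --> (0 : R) -> Z x -> 0 < d ->
  \forall z \near x & n \near \oo,
    Z z -> BRf_eps u f (eps n) z `<=` BRf_pert u Z f d z.
Proof.
move=> fc eps0 Zx d0.
pose K : R := #|profile Y|%:R * N%:R.
have K0 : 0 <= K by rewrite mulr_ge0.
(* Coordinatewise error [c] in the factors gives error [K * c < d] in the
   Euclidean distance of the products. *)
pose c := d / (K + 1).
have K1 : 0 < K + 1 by rewrite ltr_wpDl.
have c0 : 0 < c by rewrite divr_gt0.
have close (i : 'I_N) : \forall z \near x & n \near \oo, Z z ->
    forall p, BRi_eps u (eps n) (f i z) p ->
      exists2 s, BRi u (f i x) s & forall a, `|p a - s a| <= c.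
  have [g g0 H] := BRi_near u (f i x).
  (* The bound [(e + 2 * t) / g] is at most [c] once [e] and [t] are at most
     [c * g / 3]. *)
  have cg0 : 0 < c * g / 3 by rewrite !(divr_gt0, mulr_gt0).
  near=> z n => /= Zz p pBR.
  have [|s sBR ps] := H (f i z) p (eps n) (c * g / 3) _ pBR.
    by move: Zz; near: z; exact: pure_payoff_near.
  exists s => // a; apply: le_trans (ps a) _.
  rewrite ler_pdivrMr//.
  suff : `|eps n| <= c * g / 3 by rewrite ler_norml => /andP[_]; lra.
  by near: n; have /cvgr0_norm_le := eps0; apply.
have xnear : \forall z \near x & n \near \oo,
    eucl_norm (fun k => (x - z) ord0 k) < d.
  by near=> z n => /=; near: z; exact: eucl_norm_near.
apply: filterS2 (filter_forall _ close) xnear.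
move=> -[z n] /= cl xz Zz _ [p pBR <-].
have ex_s i : exists s, BRi u (f i x) s /\ forall a, `|p i a - s a| <= c.
  by have [s] := cl i Zz _ (pBR i); exists s.
pose s i := projT1 (cid (ex_s i)).
have sP i : BRi u (f i x) (s i) /\ forall a, `|p i a - s i a| <= c.
  exact: projT2 (cid (ex_s i)).
exists x; split=> //.
apply: le_lt_trans (dist_BRf_le (c := c) (s := s) _ _ _ _) _.
- exact: ltW.
- by move=> i; have [] := pBR i.
- by move=> i; have [] := sP i.
- by move=> i; have [] := sP i.
- by rewrite lte_fin mulrA -/K /c mulrCA gtr_pMr// ltr_pdivrMr// mul1r ltrDl.
Unshelve. all: by end_near. Qed.

(** A crude radius that does not depend on [z] or [e]: coordinates of
    distributions differ by at most 1, so it only matters that an exact best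
    response exists.  It provides radii for the finitely many small indices. *)
Lemma BRf_eps_sub_pert (e : R) (z : 'rV[R]_m) : Z z ->
  BRf_eps u f e z
    `<=` BRf_pert u Z f (#|profile Y|%:R * N%:R + 1) z.
Proof.
move=> Zz _ [p pBR <-].
have ex_s i : exists s, BRi u (f i z) s.
  have [g _ H] := BRi_near u (f i z).
  (* [BRi_near] without perturbation of the payoffs, for its existence part. *)
  have [a|s sBR _] := H (f i z) (p i) e 0 _ (pBR i); last by exists s.
  by rewrite subrr normr0.
pose s i := projT1 (cid (ex_s i)).
have sBR i : BRi u (f i z) (s i) by exact: projT2 (cid (ex_s i)).
have K0 : 0 <= #|profile Y|%:R * N%:R :> R by rewrite mulr_ge0.
exists z; split=> //.
  rewrite (_ : eucl_norm _ = 0) ?ltr_wpDl//.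
  rewrite /eucl_norm big1 ?sqrtr0// => k _.
  by rewrite subrr mxE expr0n.
apply: le_lt_trans (dist_BRf_le (c := 1) (s := s) _ _ _ _) _ => //.
- by move=> i; have [] := pBR i.
- move=> i a.
  have /andP[p0 p1] := Delta_le1 a (pBR i).1.
  have /andP[s0 s1] := Delta_le1 a (sBR i).1.
  by rewrite ler_norml; apply/andP; split; lra.
- by rewrite mulr1 lte_fin ltrDl.
Qed.

End Perturbation.

(** The infimum of the radii that satisfy [P n] tends to 0 but may fail [P n]
    or vanish; adding a positive sequence that tends to 0 mends both. *)
Lemma vanishing_radii (R : realType) (P : nat -> R -> Prop) (D : R) :
  0 < D -> (forall n, P n D) ->
  (forall n d d', d <= d' -> P n d -> P n d') ->
  (forall d, 0 < d -> \forall n \near \oo, P n d) ->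
  exists delta : nat -> R,
    [/\ forall n, 0 < delta n, delta n @[n --> \oo] --> (0 : R) &
        forall n, P n (delta n)].
Proof.
move=> D0 PD Pmono Pnear.
pose S n := [set d : R | 0 < d /\ P n d].
have S0 n : S n !=set0 by exists D; split.
have Slb n : lbound (S n) 0 by move=> d [/ltW].
have infS0 n : 0 <= inf (S n) by exact: lb_le_inf.
have h0 n : 0 < harmonic n :> R by rewrite invr_gt0.
exists (fun n => inf (S n) + harmonic n); split.
- by move=> n; rewrite ltr_wpDl.
- rewrite -[X in _ --> X]addr0; apply: cvgD; last exact: cvg_harmonic.
  apply/cvgr0Pnorm_le => d d0; near=> n.
  rewrite ger0_norm//; apply: ge_inf; first by exists 0.
  by split=> //; near: n; exact: Pnear.
- move=> n; have [|d [_ Pd] dinf] := @inf_adherent _ (S n) _ (h0 n).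
    by split=> //; exists 0.
  exact: Pmono (ltW dinf) Pd.
Unshelve. all: by end_near. Qed.

Theorem lemma4p2 (R : realType)
    (N : nat) (hN : (0 < N)%N)
    (Y : 'I_N -> finType) (hY : forall i : 'I_N, (0 < #|Y i|)%N)
    (u : 'I_N -> profile Y -> R)
    (m : nat) (Z : set 'rV[R]_m) (hZ : compact Z)
    (f : forall i : 'I_N, 'rV[R]_m -> profile_others Y i -> R)
    (hf : forall (i : 'I_N) (z : 'rV[R]_m), Z z ->
            Delta R (profile_others Y i) (f i z))
    (hfc : forall i : 'I_N,
       {within Z, continuous
          (f i : 'rV[R]_m -> {ptws profile_others Y i -> R})})
    (eps : nat -> R) (heps0 : forall n, 0 <= eps n)
    (heps : eps n @[n --> \oo] --> (0 : R)) :
  exists delta : nat -> R,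
    [/\ forall n, 0 < delta n,
        delta n @[n --> \oo] --> (0 : R) &
        forall (n : nat) (z : 'rV[R]_m), Z z ->
          BRf_eps u f (eps n) z `<=` BRf_pert u Z f (delta n) z].
Proof.
apply: (@vanishing_radii R
  (fun n d => forall z, Z z -> BRf_eps u f (eps n) z `<=` BRf_pert u Z f d z)
  (#|profile Y|%:R * N%:R + 1)).
- by rewrite ltr_wpDl// mulr_ge0.
- by move=> n z Zz; exact: BRf_eps_sub_pert.
- move=> n d d' dd' H z Zz.
  by apply: subset_trans (H z Zz) _; exact: BRf_pert_mono.
- move=> d d0; have /compact_near_coveringP cZ := hZ.
  apply: filterS (cZ nat \oo (fun n z => Z z ->
      BRf_eps u f (eps n) z `<=` BRf_pert u Z f d z) _
    (fun x Zx => BRf_eps_near u hfc heps Zx d0)) => n H z Zz.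
  exact: H.
Qed.
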